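(* Let $K:\mathbb B_d\times\mathbb B_d\to\mathcal M_d(\mathbb C)$ be a non-negative definite kernel of the form $$K(\boldsymbol z,\boldsymbol w)=\sum_{\ell=1}^\infty(a_{\ell,1}-a_{\ell,2})\langle\boldsymbol z,\boldsymbol w\rangle^{\ell-1}\bar{\boldsymbol w}\boldsymbol z^\dagger+\sum_{\ell=0}^\infty a_{\ell,2}\langle\boldsymbol z,\boldsymbol w\rangle^\ell I_d,$$ with complex numbers $a_{\ell,1}$ ($\ell\ge1$), $a_{\ell,2}$ ($\ell\ge0$), and set $a_{0,1}:=a_{0,2}$. Then the $d$-tuple $\boldsymbol M$ of multiplication by the coordinate functions on $\mathcal H_K(\mathbb B_d,\mathbb C^d)$ is bounded if and only if $$\sup_{\ell\ge1}\Big\{\frac{(\ell+1)a_{\ell-1,2}-a_{\ell-1,1}}{(\ell+1)a_{\ell,2}-a_{\ell,1}},\ \frac{a_{\ell-1,1}}{a_{\ell,1}}\Big\}<\infty.$$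
   Context: $\mathbb B_d$ is the unit ball of $\mathbb C^d$, $\langle\boldsymbol z,\boldsymbol w\rangle=\sum_iz_i\bar w_i$, and $\bar{\boldsymbol w}\boldsymbol z^\dagger$ is the $d\times d$ matrix with $(i,j)$ entry $\bar w_iz_j$. $\mathcal H_K(\mathbb B_d,\mathbb C^d)$ is the reproducing kernel Hilbert space of $\mathbb C^d$-valued holomorphic functions with kernel $K$.
   Formalization: The formal theorem assumes d ≥ 2 (for d = 1 the coefficients a_{ℓ,2}, ℓ ≥ 1, cancel from K and the criterion fails) and that the denominators a_{ℓ,1} and (ℓ+1)a_{ℓ,2} − a_{ℓ,1} are nonzero for ℓ ≥ 1, so that the quotients are defined. *)

(* Defs.v *)
From HB Require Import structures.
From mathcomp Require Import all_boot all_order all_algebra.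
From mathcomp Require Import all_classical all_reals all_analysis.
From mathcomp Require Import complex.
Set Implicit Arguments. Unset Strict Implicit. Unset Printing Implicit Defensive.
Import Order.TTheory GRing.Theory Num.Theory.
Import numFieldNormedType.Exports.
Local Open Scope ring_scope.
Local Open Scope complex_scope.
Local Open Scope classical_set_scope.

Section Defs.
Variable R : realType.
Local Notation C := (R[i]).

Definition cinner (d : nat) (z w : 'cV[C]_d) : C :=
  \sum_(i < d) z i 0 * (w i 0)^*.

Definition in_ball (d : nat) (z : 'cV[C]_d) : Prop := `|cinner z z| < 1.

Definition wbar_zdag (d : nat) (z w : 'cV[C]_d) : 'M[C]_d :=
  \matrix_(i, j) ((w i 0)^* * z j 0).

Definition seriesA (a1 a2 : nat -> C) (t : C) : nat -> C^o :=
  series (fun k => (a1 k.+1 - a2 k.+1) * t ^+ k).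
Definition seriesB (a2 : nat -> C) (t : C) : nat -> C^o :=
  series (fun l => a2 l * t ^+ l).

Definition Kker (d : nat) (a1 a2 : nat -> C) (z w : 'cV[C]_d) : 'M[C]_d :=
  lim (seriesA a1 a2 (cinner z w) @ \oo) *: wbar_zdag z w
  + lim (seriesB a2 (cinner z w) @ \oo) *: 1%:M.

Definition nonneg_def_kernel (d : nat) (K : 'cV[C]_d -> 'cV[C]_d -> 'M[C]_d)
  : Prop :=
  forall (n : nat) (z xi : 'I_n -> 'cV[C]_d), (forall j, in_ball (z j)) ->
    0 <= \sum_(i < n) \sum_(j < n) cinner (K (z i) (z j) *m xi j) (xi i).

(* f belongs to H_K(B_d, C^d) with ||f||^2 <= c (Aronszajn's description of the
   RKHS: |<f, sum_j K(., z_j) xi_j>|^2 <= c || sum_j K(., z_j) xi_j ||^2 ). *)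
Definition inHK (d : nat) (K : 'cV[C]_d -> 'cV[C]_d -> 'M[C]_d)
  (f : 'cV[C]_d -> 'cV[C]_d) (c : R) : Prop :=
  forall (n : nat) (z xi : 'I_n -> 'cV[C]_d), (forall j, in_ball (z j)) ->
    `|\sum_(j < n) cinner (f (z j)) (xi j)| ^+ 2
      <= c%:C * \sum_(i < n) \sum_(j < n) cinner (K (z i) (z j) *m xi j) (xi i).

Definition mult_tuple_bounded (d : nat) (K : 'cV[C]_d -> 'cV[C]_d -> 'M[C]_d)
  : Prop :=
  exists Cst : R, forall (i : 'I_d) (f : 'cV[C]_d -> 'cV[C]_d) (c : R),
    inHK K f c -> inHK K (fun z => z i 0 *: f z) (Cst * c).

Definition a1ext (a1 a2 : nat -> C) (l : nat) : C :=
  if l == 0%N then a2 0%N else a1 l.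

End Defs.

(* Main.v *)
(* Homogeneous C^d-valued forms [f] of degree [l] split into gradients and
   fields with [z . f z = 0]. With [p = <z, w>], the two parts have kernels
     G_l = p^l I + l p^(l-1) conj(w) z^T,   N_l = p^l I - p^(l-1) conj(w) z^T,
   and the degree [l] part of K is
     (a1_l / (l+1)) G_l + (((l+1) a2_l - a1_l) / (l+1)) N_l,
   so K is nonnegative iff all these weights are. The multiplication operators
   are bounded iff [(c - p) K] is nonnegative for some c; as this kernel has the
   same shape, with coefficients [c a1_l - a1_(l-1)] and [c a2_l - a2_(l-1)],
   nonnegativity of its weights is the bound on the two quotients. *)
Require Import Defs.
From HB Require Import structures.
From mathcomp Require Import all_boot all_order all_algebra.
From mathcomp Require Import all_classical all_reals all_analysis.
From mathcomp Require Import complex ring.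
Import Order.TTheory GRing.Theory Num.Theory.
Import numFieldNormedType.Exports.
Set Implicit Arguments.
Unset Strict Implicit.
Unset Printing Implicit Defensive.
Local Open Scope ring_scope.
Local Open Scope classical_set_scope.

(** * Positivity of the homogeneous parts of the kernel *)

Section Forms.
Variable F : numClosedFieldType.
Implicit Types (T : finType) (d : nat).

(** The order on [F] is partial, so reality of [x] has to be derived too: [|x| - x] has norm at most
    [2 * |y|], and it vanishes exactly when [x] is nonnegative. *)
Lemma ge0_approx (x : F) :
  (forall e : F, 0 < e -> exists2 y, `|y| <= e & 0 <= x + y) -> 0 <= x.
Proof.
move=> approx; suff /eqP : `|x| - x = 0 by rewrite subr_eq0 => /eqP <-.
apply/eqP; rewrite -normr_le0; apply/ler_addgt0Pr => e e0.
have e2 : 0 < e / 2 by rewrite divr_gt0.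
have [y ye xy] := approx _ e2.
have -> : `|x| - x = (`|x| - `|x + y|) + y by rewrite (ger0_norm xy); ring.
apply: le_trans (ler_normD _ _) _; rewrite add0r [leRHS]splitr lerD//.
by rewrite (le_trans (ler_dist_dist _ _))// opprD addNKr normrN.
Qed.

(** A positive semidefinite 2 x 2 matrix has nonnegative determinant; it is Hermitian because the
    form is real at [(1, 1)] and [(1, 'i)]. Both Cauchy-Schwarz inequalities below come from
    here. *)
Lemma cross_term_sqr_le (A E B B' : F) :
  (forall x y : F,
     0 <= x * x^* * A + y * y^* * E + x^* * y * B + x * y^* * B') ->
  `|B| ^+ 2 <= A * E.
Proof.
move=> pos.
have A0 : 0 <= A by have := pos 1 0; rewrite !conjC0 !conjC1 !(mul0r, mulr0, addr0, mul1r).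
have E0 : 0 <= E by have := pos 0 1; rewrite !conjC0 !conjC1 !(mul0r, mulr0, addr0, mul1r, add0r).
have cA : A^* = A by apply: conj_Creal; exact: ger0_real.
have cE : E^* = E by apply: conj_Creal; exact: ger0_real.
have HB : B' = B^*.
  have H1 : (A + E + B + B')^* = A + E + B + B'.
    apply: conj_Creal; apply: ger0_real.
    by have := pos 1 1; rewrite !conjC1 !mul1r.
  have Hi : (A + E + 'i * B - 'i * B')^* = A + E + 'i * B - 'i * B'.
    apply: conj_Creal; apply: ger0_real.
    have := pos 1 'i; rewrite !conjC1 !mul1r conjCi.
    by rewrite mulrN -expr2 sqrCi opprK mul1r mulNr.
  move: H1 Hi; rewrite !rmorphB !rmorphD/= !rmorphM/= conjCi cA cE => H1 Hi.
  have h1 : B^* + B'^* = B + B'.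
    by apply: (addrI (A + E)); rewrite !addrA.
  have h2 : 'i * (B'^* - B^*) = 'i * (B - B').
    apply: (addrI (A + E)); transitivity (A + E + 'i * B - 'i * B'); last by ring.
    by rewrite -Hi; ring.
  have {}h2 : B'^* - B^* = B - B' by apply: (mulfI (@neq0Ci F)).
  have : 2 * B' = 2 * B^*.
    transitivity ((B + B') - (B - B')); first by ring.
    by rewrite -h1 -h2; ring.
  by move=> /(mulfI (_ : (2 : F) != 0)); apply; rewrite pnatr_eq0.
(* The choice [y = - B^*] turns both cross terms into [- x * |B|^2]. Then [x] is taken to be [E] or
   [A], whichever is positive, or 1 if both vanish. *)
have key x : 0 <= x -> 2 * x * `|B| ^+ 2 <= x ^+ 2 * A + `|B| ^+ 2 * E.
  move=> x0; have := pos x (- B^*).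
  have -> : x^* = x by apply: conj_Creal; exact: ger0_real.
  rewrite HB rmorphN/= conjCK => h; rewrite -subr_ge0 normCK.
  apply: le_trans h _; rewrite le_eqVlt; apply/orP; left; apply/eqP; ring.
have key' x : 0 <= x -> 2 * x * `|B| ^+ 2 <= x ^+ 2 * E + `|B| ^+ 2 * A.
  move=> x0; have := pos (- B) x.
  have -> : x^* = x by apply: conj_Creal; exact: ger0_real.
  rewrite HB rmorphN/= => h; rewrite -subr_ge0 normCK.
  apply: le_trans h _; rewrite le_eqVlt; apply/orP; left; apply/eqP; ring.
move: A0 E0; rewrite !le0r => /orP[/eqP A0|A0] /orP[/eqP E0|E0].
- have := key 1 ler01; rewrite A0 E0 !mulr0 addr0 mulr1.
  by rewrite pmulr_rle0.
- have := key' A; rewrite A0 => /(_ (lexx _)) _.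
  have := key E (ltW E0); rewrite A0 mulr0 add0r mul0r.
  rewrite -subr_ge0; have -> : `|B| ^+ 2 * E - 2 * E * `|B| ^+ 2 = - (`|B| ^+ 2 * E) by ring.
  by rewrite oppr_ge0 pmulr_lle0.
- have := key' A (ltW A0); rewrite E0 !mulr0 add0r.
  rewrite -subr_ge0; have -> : `|B| ^+ 2 * A - 2 * A * `|B| ^+ 2 = - (`|B| ^+ 2 * A) by ring.
  by rewrite oppr_ge0 pmulr_lle0.
- have := key E (ltW E0); rewrite -subr_ge0.
  have -> : E ^+ 2 * A + `|B| ^+ 2 * E - 2 * E * `|B| ^+ 2 = (A * E - `|B| ^+ 2) * E by ring.
  by rewrite pmulr_lge0// subr_ge0.
Qed.

Definition ip d (z w : 'cV[F]_d) : F := \sum_(k < d) z k 0 * (w k 0)^*.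
Definition dp d (z x : 'cV[F]_d) : F := \sum_(k < d) z k 0 * x k 0.

Lemma gram_ge0 T (f : T -> F) : 0 <= \sum_i \sum_j f i * (f j)^*.
Proof.
under eq_bigr do rewrite -mulr_sumr -rmorph_sum.
by rewrite -mulr_suml mul_conjC_ge0.
Qed.

(* The Gram matrix of the tensors [c z^(n) + c' D], where [D] is the
   derivative of the n-th tensor power at [z] in the direction [y]; the step
   [n -> n + 1] splits off the last tensor factor. *)
Lemma tensor_gram_ge0 d n T (c c' : T -> F) (z y : T -> 'cV[F]_d) :
  0 <= \sum_i \sum_j (c i * (c j)^* * ip (z i) (z j) ^+ n
    + c' i * (c j)^* * (n%:R * ip (z i) (z j) ^+ n.-1 * ip (y i) (z j))
    + c i * (c' j)^* * (n%:R * ip (z i) (z j) ^+ n.-1 * ip (z i) (y j))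
    + c' i * (c' j)^* * (n%:R * ip (z i) (z j) ^+ n.-1 * ip (y i) (y j)
        + n%:R * n.-1%:R * ip (z i) (z j) ^+ n.-2 * ip (y i) (z j)
          * ip (z i) (y j))).
Proof.
elim: n c c' => [|n IH] c c'.
  rewrite (eq_bigr (fun i => \sum_j c i * (c j)^*)) ?gram_ge0// => i _.
  by apply: eq_bigr => j _; rewrite expr0; ring.
(* Leibniz rule, in coordinate [k] of the last factor: [c z + c' y] multiplies the n-th tensor power
   and [c' z] multiplies its derivative. *)
pose b k i := c i * z i k 0 + c' i * y i k 0.
pose b' k i := c' i * z i k 0.
have := sumr_ge0 (index_enum 'I_d) (fun k _ => IH (b k) (b' k)).
move=> /(_ predT); rewrite exchange_big/=; congr (0 <= _); apply: eq_bigr => i _.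
rewrite exchange_big/=; apply: eq_bigr => j _.
set p := ip (z i) (z j); set q := ip (y i) (z j).
set r := ip (z i) (y j); set s := ip (y i) (y j).
set P1 := n%:R * p ^+ n.-1; set P2 := n%:R * n.-1%:R * p ^+ n.-2.
have expand u v u' v' : p * u + q * v + r * u' + s * v' = \sum_k
    (z i k 0 * (z j k 0)^* * u + y i k 0 * (z j k 0)^* * v
     + z i k 0 * (y j k 0)^* * u' + y i k 0 * (y j k 0)^* * v').
  by rewrite /p /q /r /s !mulr_suml -!big_split.
transitivity (p * (c i * (c j)^* * p ^+ n + c' i * (c j)^* * (P1 * q)
      + c i * (c' j)^* * (P1 * r) + c' i * (c' j)^* * (P1 * s + P2 * q * r))
    + q * (c' i * (c j)^* * p ^+ n + c' i * (c' j)^* * (P1 * r))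
    + r * (c i * (c' j)^* * p ^+ n + c' i * (c' j)^* * (P1 * q))
    + s * (c' i * (c' j)^* * p ^+ n)).
  rewrite expand; apply: eq_bigr => k _.
  by rewrite /b /b' !rmorphD/= !rmorphM/=; ring.
by rewrite /P1 /P2; case: (n) => [|[|m]] /=; rewrite ?expr0 ?exprS -?natr1; ring.
Qed.

(* The degree [l] part of [<K(z, w) x, y>]. *)
Definition kterm (a1 a2 : nat -> F) d l (z w x y : 'cV[F]_d) : F :=
  a2 l * ip z w ^+ l * ip x y
  + (if l is k.+1
     then (a1 l - a2 l) * ip z w ^+ k * (dp z x * (dp w y)^*) else 0).

Definition kform (a1 a2 : nat -> F) d l T (z x : T -> 'cV[F]_d) : F :=
  \sum_i \sum_j kterm a1 a2 l (z i) (z j) (x j) (x i).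

(** With [c = 0], [c' = 1] and direction [conj x], [tensor_gram_ge0] is about the derivatives of the
    tensor power [l + 1]; their Gram matrix gives [l + 1] times this form. *)
Lemma gradient_form_ge0 d l T (z x : T -> 'cV[F]_d) :
  0 <= \sum_i \sum_j (ip (z i) (z j) ^+ l * ip (x j) (x i)
      + l%:R * ip (z i) (z j) ^+ l.-1 * (dp (z i) (x j) * (dp (z j) (x i))^*)).
Proof.
have := tensor_gram_ge0 l.+1 (fun _ => 0) (fun _ => 1) z (fun i => map_mx Num.conj (x i)).
set S := (X in is_true (_ <= X) -> _); set S' := (X in _ -> is_true (_ <= X)).
suff -> : S = l.+1%:R * S' by rewrite pmulr_rge0// ltr0n.
rewrite mulr_sumr; apply: eq_bigr => i _; rewrite mulr_sumr; apply: eq_bigr => j _.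
have -> : ip (map_mx Num.conj (x i)) (map_mx Num.conj (x j)) = ip (x j) (x i).
  by apply: eq_bigr => k _; rewrite !mxE conjCK mulrC.
have -> : ip (z i) (map_mx Num.conj (x j)) = dp (z i) (x j).
  by apply: eq_bigr => k _; rewrite !mxE conjCK.
have -> : ip (map_mx Num.conj (x i)) (z j) = (dp (z j) (x i))^*.
  by rewrite rmorph_sum; apply: eq_bigr => k _; rewrite !mxE rmorphM mulrC.
by rewrite conjC0 conjC1 /=; ring.
Qed.

(** For [l = 0], Lagrange's identity writes twice the form as a sum of Gram matrices of the minors
    [z_a conj(x_b) - z_b conj(x_a)]. Each further factor [ip (z i) (z j)] splits over the
    coordinates [k] and is absorbed by scaling [x i] with [(z i k 0)^*]. *)
Lemma radial_free_form_ge0 d l T (z x : T -> 'cV[F]_d) :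
  0 <= \sum_i \sum_j ip (z i) (z j) ^+ l
      * (ip (z i) (z j) * ip (x j) (x i) - dp (z i) (x j) * (dp (z j) (x i))^*).
Proof.
elim: l x => [|l IH] x.
  pose f (a b : 'I_d) i := z i a 0 * (x i b 0)^* - z i b 0 * (x i a 0)^*.
  have : 0 <= \sum_a \sum_b \sum_i \sum_j f a b i * (f a b j)^*.
    by apply: sumr_ge0 => a _; apply: sumr_ge0 => b _; exact: gram_ge0.
  set S := (X in is_true (_ <= X) -> _); set S' := (X in _ -> is_true (_ <= X)).
  suff -> : S = 2 * S' by rewrite pmulr_rge0// ltr0n.
  rewrite /S pair_big/= exchange_big/= mulr_sumr; apply: eq_bigr => i _.
  rewrite exchange_big/= mulr_sumr; apply: eq_bigr => j _.
  rewrite -(pair_big xpredT xpredT (fun a b => f a b i * (f a b j)^*))/=.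
  rewrite expr0 mul1r /f.
  pose g a b := z i a 0 * (z j a 0)^* * (x j b 0 * (x i b 0)^*).
  pose h a b := z i a 0 * x j a 0 * ((z j b 0)^* * (x i b 0)^*).
  have -> : ip (z i) (z j) * ip (x j) (x i) = \sum_a \sum_b g a b.
    by rewrite /ip big_distrlr.
  have -> : dp (z i) (x j) * (dp (z j) (x i))^* = \sum_a \sum_b h a b.
    rewrite /dp rmorph_sum big_distrlr/=; apply: eq_bigr => a _.
    by apply: eq_bigr => b _; rewrite rmorphM.
  have exch (u : 'I_d -> 'I_d -> F) :
    2 * (\sum_a \sum_b u a b) = \sum_a \sum_b (u a b + u b a).
    under [RHS]eq_bigr do rewrite big_split.
    by rewrite big_split/= [X in _ + X]exchange_big/= mulr_natl mulr2n.
  rewrite mulrBr !exch.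
  rewrite -!sumrN -!big_split/=; apply: eq_bigr => a _.
  rewrite -!sumrN -!big_split/=; apply: eq_bigr => b _.
  by rewrite /g /h rmorphB/= !rmorphM/= !conjCK; ring.
have := sumr_ge0 (index_enum 'I_d) (fun k _ => IH (fun i => (z i k 0)^* *: x i)).
move=> /(_ predT); rewrite exchange_big/=; congr (0 <= _); apply: eq_bigr => i _.
rewrite exchange_big/=; apply: eq_bigr => j _.
rewrite exprS -mulrA [X in _ = X * _]/ip mulr_suml; apply: eq_bigr => k _.
have ipZ u v : ip (u *: x j) (v *: x i) = u * v^* * ip (x j) (x i).
  by rewrite /ip mulr_sumr; apply: eq_bigr => m _; rewrite !mxE rmorphM/=; ring.
have dpZ u v w : dp v (u *: x w) = u * dp v (x w).
  by rewrite /dp mulr_sumr; apply: eq_bigr => m _; rewrite !mxE; ring.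
by rewrite ipZ !dpZ rmorphM/= conjCK; ring.
Qed.

Lemma kform_ge0 (a1 a2 : nat -> F) d l T (z x : T -> 'cV[F]_d) :
  ((0 < l)%N -> 0 <= a1 l /\ 0 <= l.+1%:R * a2 l - a1 l) -> 0 <= a2 0%N ->
  0 <= kform a1 a2 l z x.
Proof.
case: l => [_ a20|l /(_ isT) [a1l a12l] _].
  have := gradient_form_ge0 0 z x => /(mulr_ge0 a20).
  congr (0 <= _); rewrite mulr_sumr; apply: eq_bigr => i _; rewrite mulr_sumr.
  by apply: eq_bigr => j _; rewrite /kterm expr0; ring.
suff -> : kform a1 a2 l.+1 z x = l.+2%:R^-1 * (
    a1 l.+1 * (\sum_i \sum_j (ip (z i) (z j) ^+ l.+1 * ip (x j) (x i)
      + l.+1%:R * ip (z i) (z j) ^+ l * (dp (z i) (x j) * (dp (z j) (x i))^*)))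
    + (l.+2%:R * a2 l.+1 - a1 l.+1) * (\sum_i \sum_j ip (z i) (z j) ^+ l
      * (ip (z i) (z j) * ip (x j) (x i)
         - dp (z i) (x j) * (dp (z j) (x i))^*))).
  apply: mulr_ge0; first by rewrite invr_ge0 ler0n.
  apply: addr_ge0; apply: mulr_ge0 => //; first exact: (gradient_form_ge0 l.+1 z x).
  exact: radial_free_form_ge0.
rewrite !mulr_sumr -big_split/= mulr_sumr; apply: eq_bigr => i _.
rewrite !mulr_sumr -big_split/= mulr_sumr; apply: eq_bigr => j _.
have l20 : l.+2%:R != 0 :> F by rewrite pnatr_eq0.
apply: (mulfI l20); rewrite mulVKf// /kterm exprS -[l.+2%:R]natr1.
by ring.
Qed.

(** * Recovery of the weights from nonnegative forms *)

Lemma moment_weights N k : (k < N)%N ->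
  exists v : 'I_N -> F, forall l, (l < N)%N ->
    \sum_a v a * a%:R ^+ l = (l == k)%:R.
Proof.
(* The nodes [0, ..., N - 1] are distinct in characteristic 0, so their Vandermonde matrix is
   invertible and the moments below [N] can be prescribed. *)
move=> kN; pose V : 'M[F]_N := Vandermonde N (\row_(j < N) j%:R).
have Vu : V \in unitmx.
  rewrite unitmxE det_Vandermonde unitfE; apply/prodf_neq0 => i _.
  apply/prodf_neq0 => j ij; rewrite !mxE subr_eq0 eqr_nat.
  by rewrite gtn_eqF.
pose v := invmx V *m delta_mx (Ordinal kN) (0 : 'I_1).
exists (fun a => v a 0) => l lN.
have : (V *m v) (Ordinal lN) 0 = (l == k)%:R.
  by rewrite /v mulKVmx// mxE andbT.
by rewrite mxE => <-; apply: eq_bigr => a _; rewrite !mxE mulrC.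
Qed.

Definition plane_vec d (i0 i1 : 'I_d) (x y : F) : 'cV[F]_d :=
  \col_k (if k == i0 then x else if k == i1 then y else 0).

Lemma ip_plane_vec d (i0 i1 : 'I_d) (x y x' y' : F) : i0 != i1 ->
  ip (plane_vec i0 i1 x y) (plane_vec i0 i1 x' y') = x * x'^* + y * y'^*.
Proof.
move=> i01; have i10 : i1 != i0 by rewrite eq_sym.
rewrite /ip (bigD1 i0)//= (bigD1 i1)//= big1 => [|k].
  by rewrite !mxE !eqxx (negbTE i10) addr0.
by move=> /andP[/negbTE k0 /negbTE k1]; rewrite !mxE k0 k1 mul0r.
Qed.

Lemma dp_plane_vec d (i0 i1 : 'I_d) (x y x' y' : F) : i0 != i1 ->
  dp (plane_vec i0 i1 x y) (plane_vec i0 i1 x' y') = x * x' + y * y'.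
Proof.
move=> i01; have i10 : i1 != i0 by rewrite eq_sym.
rewrite /dp (bigD1 i0)//= (bigD1 i1)//= big1 => [|k].
  by rewrite !mxE !eqxx (negbTE i10) addr0.
by move=> /andP[/negbTE k0 /negbTE k1]; rewrite !mxE k0 k1 mul0r.
Qed.

(** The binomial expansion yields ['C(n, k)] times the squared modulus of the k-th moment of [b],
    and only [k = 1] survives. *)
Lemma binomial_moments N n (b : 'I_N -> F) : (n < N)%N ->
  (forall l, (l < N)%N -> \sum_a b a * a%:R ^+ l = (l == 1%N)%:R) ->
  \sum_i \sum_j b j * (b i)^* * (1 + (i : nat)%:R * (j : nat)%:R) ^+ n = n%:R.
Proof.
move=> nN bm.
transitivity (\sum_(k < n.+1) ((\sum_j b j * j%:R ^+ k)
    * (\sum_i b i * i%:R ^+ k)^*) *+ 'C(n, k)).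
  transitivity (\sum_i \sum_j \sum_(k < n.+1)
      (b j * j%:R ^+ k * (b i * i%:R ^+ k)^*) *+ 'C(n, k)).
    apply: eq_bigr => i _; apply: eq_bigr => j _; rewrite exprDn mulr_sumr.
    apply: eq_bigr => k _; rewrite expr1n mul1r rmorphM rmorphXn/= conjC_nat.
    by rewrite exprMn mulrnAr; congr (_ *+ _); ring.
  under eq_bigr do rewrite exchange_big.
  rewrite exchange_big; apply: eq_bigr => k _ /=.
  rewrite rmorph_sum big_distrlr/= exchange_big -sumrMnl; apply: eq_bigr => i _.
  by rewrite -sumrMnl.
case: n nN => [|n] nN.
  by rewrite big_ord1 bm// mul0r mul0rn.
rewrite (bigD1 (Ordinal (isT : (1 < n.+2)%N)))//= bm ?(leq_ltn_trans _ nN)//.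
rewrite eqxx conjC1 mulr1 bin1 big1 ?addr0// => k.
rewrite -val_eqE/= => /negbTE k1.
by rewrite bm ?k1 ?mul0r ?mul0rn// (leq_trans _ nN)// ltnS -ltnS.
Qed.

Lemma coef0_ge0 (a1 a2 : nat -> F) d : (0 < d)%N ->
  (forall T (z x : T -> 'cV[F]_d), 0 <= kform a1 a2 0 z x) -> 0 <= a2 0%N.
Proof.
case: d => // d _ pos; pose e : 'cV[F]_d.+1 := delta_mx 0 0.
have := pos 'I_1 (fun=> e) (fun=> e); rewrite /kform !big_ord1 /kterm expr0.
suff -> : ip e e = 1 by rewrite !mulr1 addr0.
rewrite /ip big_ord_recl big1 => [|i _]; rewrite !mxE/= ?mul0r//.
by rewrite conjC1 mulr1 addr0.
Qed.

(* The functional [f |-> <f(e0), e1> - sum_j b_j/(m+1) <f(z_j), z_j>] with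
   [z_j = e0 + j e1] and weights [b] such that [sum_j b_j q(j) = q'(0)] for
   [deg q <= m + 1] kills the gradients of forms of degree [m + 1]: by Euler's
   identity the second part is the derivative along [e1]. It thus isolates the
   second coefficient. *)
Lemma coef_ge0 (a1 a2 : nat -> F) d m : (1 < d)%N -> (0 < m)%N ->
  (forall T (z x : T -> 'cV[F]_d), 0 <= kform a1 a2 m z x) ->
  0 <= a1 m /\ 0 <= m.+1%:R * a2 m - a1 m.
Proof.
move=> d1; case: m => // m _ pos.
pose i0 : 'I_d := Ordinal (ltnW d1); pose i1 : 'I_d := Ordinal d1.
have i01 : i0 != i1 by [].
pose e x y := plane_vec i0 i1 x y.
split.
  (* At the point [e0] in the direction [e0], the two terms of [kterm] add up to [a1]. *)
  have := pos 'I_1 (fun=> e 1 0) (fun=> e 1 0); rewrite /kform !big_ord1 /kterm.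
  rewrite ip_plane_vec// dp_plane_vec// !(conjC0, mulr0, addr0, mulr1).
  by rewrite !(conjC1, expr1n, mulr1) addrC subrK.
(* There are [m + 3] nodes because the pairs of nodes produce powers up to [m + 2]. *)
have [b bm] := @moment_weights m.+3 1 isT.
pose c : F := - m.+2%:R^-1.
have cE : c^* = c by rewrite rmorphN/= fmorphV/= conjC_nat.
pose z (t : 'I_1 + 'I_m.+3) := if t is inr j then e 1 j%:R else e 1 0.
pose x (t : 'I_1 + 'I_m.+3) :=
  if t is inr j then e (c * b j) (c * b j * j%:R) else e 0 1.
have := pos _ z x.
(* At index [m.+1], the four blocks sum to [a2 + 2 c a1 + c^2 (m + 2) a1], which is
   [a2 - a1 / (m + 2)] for this [c]. *)
suff -> : kform a1 a2 m.+1 z x = m.+2%:R^-1 * (m.+2%:R * a2 m.+1 - a1 m.+1).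
  by rewrite pmulr_rge0// invr_gt0 ltr0n.
rewrite /kform big_sumType/= big_ord1 big_sumType/= big_ord1.
under [X in _ + X]eq_bigr do rewrite big_sumType/= big_ord1.
rewrite [X in _ + X]big_split/=.
have b1 : \sum_(j < m.+3) b j * j%:R = 1.
  by rewrite -[RHS](bm 1%N)//; apply: eq_bigr => j _; rewrite expr1.
have -> : kterm a1 a2 m.+1 (e 1 0) (e 1 0) (e 0 1) (e 0 1) = a2 m.+1.
  rewrite /kterm !ip_plane_vec// !dp_plane_vec// conjC0 conjC1.
  by rewrite !(mul0r, mulr0, mul1r, addr0, add0r) expr1n !mulr1.
have -> : \sum_(j < m.+3) kterm a1 a2 m.+1 (e 1 0) (e 1 j%:R)
    (e (c * b j) (c * b j * j%:R)) (e 0 1) = c * a1 m.+1.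
  transitivity (c * a1 m.+1 * \sum_(j < m.+3) b j * j%:R); last by rewrite b1 mulr1.
  rewrite mulr_sumr; apply: eq_bigr => j _.
  rewrite /kterm !ip_plane_vec// !dp_plane_vec// conjC0 conjC1 conjC_nat.
  rewrite !(mul0r, mulr0, mul1r, mulr1, addr0, add0r) !expr1n conjC_nat.
  by ring.
have -> : \sum_(i < m.+3) kterm a1 a2 m.+1 (e 1 i%:R) (e 1 0)
    (e 0 1) (e (c * b i) (c * b i * i%:R)) = c * a1 m.+1.
  transitivity (c * a1 m.+1 * (\sum_(j < m.+3) b j * j%:R)^*).
    rewrite rmorph_sum mulr_sumr; apply: eq_bigr => j _.
    rewrite /kterm !ip_plane_vec// !dp_plane_vec// conjC0 conjC1 !rmorphM/= conjC_nat cE.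
    rewrite !(mul0r, mulr0, mul1r, mulr1, addr0, add0r) !expr1n !rmorphM/= cE.
    by ring.
  by rewrite b1 conjC1 mulr1.
have -> : \sum_(i < m.+3) \sum_(j < m.+3) kterm a1 a2 m.+1 (e 1 i%:R) (e 1 j%:R)
    (e (c * b j) (c * b j * j%:R)) (e (c * b i) (c * b i * i%:R))
    = c * c * a1 m.+1 * m.+2%:R.
  rewrite -(binomial_moments (_ : m.+2 < m.+3)%N bm)// mulr_sumr.
  apply: eq_bigr => i _; rewrite mulr_sumr; apply: eq_bigr => j _.
  rewrite /kterm !ip_plane_vec// !dp_plane_vec// conjC1 !rmorphM/= !conjC_nat cE.
  rewrite rmorphD/= !rmorphM/= !conjC_nat cE conjC1 !exprS !mulr1; ring.
rewrite /c; have : m.+2%:R != 0 :> F by rewrite pnatr_eq0.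
by move: (m.+2%:R) => M M0; field.
Qed.

End Forms.

(** * Power series and the sign of their coefficients *)

Section KernelSeries.
Variable F : numClosedFieldType.
Implicit Types (T : finType) (d : nat).

Lemma series_ge0 (u : nat -> F^o) (l : F^o) :
  series u @ \oo --> l -> (forall n, 0 <= u n) -> 0 <= (l : F).
Proof.
move=> ul u0; apply: ge0_approx => e e0.
move/cvgrPdist_lt : ul => /(_ _ e0)[N _ /(_ N (leqnn N)) /ltW HN].
exists (series u N - l); first by rewrite distrC.
by rewrite addrC subrK; apply: sumr_ge0 => *; exact: u0.
Qed.

Lemma geometric_sum_le2 (t : F) n : 0 <= t -> t <= 2^-1 ->
  \sum_(j < n) t ^+ j <= 2.
Proof.
(* Adding [2 * t ^+ n] makes the sums nonincreasing in [n], with initial value 2. *)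
move=> t0 t2; apply: (@le_trans _ _ (\sum_(j < n) t ^+ j + 2 * t ^+ n)).
  by rewrite lerDl mulr_ge0// exprn_ge0.
elim: n => [|n IH]; first by rewrite big_ord0 add0r expr0 mulr1.
apply: le_trans IH; rewrite big_ord_recr/= -addrA lerD2l exprS mulrA.
have -> : 2 * t ^+ n = t ^+ n + t ^+ n by ring.
rewrite lerD2l ler_piMl ?exprn_ge0//.
by rewrite -ler_pdivlMl ?ltr0n// mulr1.
Qed.

(** The sum divided by [t ^+ m] tends to [c m] as [t] tends to 0. Quantitatively, terms bounded by
    [M] at [t0] leave at [h * t0] a tail of at most [2 * M * h ^+ m.+1]. *)
Lemma lead_coef_ge0 (c : nat -> F) m (t0 : F) : 0 < t0 ->
  (forall t, 0 < t -> t <= t0 -> exists2 s : F^o,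
     series (fun l => c l * t ^+ l : F^o) @ \oo --> s & 0 <= (s : F)) ->
  (forall l, (l < m)%N -> c l = 0) -> 0 <= c m.
Proof.
move=> t00 sums cm.
have [M M0 cM] : exists2 M, 0 <= M & forall l, `|c l * t0 ^+ l| <= M.
  have [s cvs _] := sums t0 t00 (lexx _).
  have /cvg_seq_bounded[M [Mr /(_ (M + 1))]] := cvgP _ (cvg_series_cvg_0 (cvgP _ cvs)).
  rewrite ltrDl ltr01 => /(_ isT) HM; exists (M + 1) => [|l]; last exact: (HM l I).
  exact: le_trans (normr_ge0 _) (HM 0%N I).
suff : 0 <= c m * t0 ^+ m by rewrite pmulr_lge0// exprn_gt0.
(* In [D], the [2 * M] is for the tail and the 1 for truncating the series with error [h ^+ m.+1];
   [h] is chosen to satisfy both [D * h <= e] and [h <= 1/2]. *)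
apply: ge0_approx => e e0; pose D := 2 * M + 1.
have D0 : 0 < D by rewrite ltr_wpDl// mulr_ge0.
have eD0 : 0 < e + D by rewrite addr_gt0.
pose h := e / (2 * (e + D)).
have h0 : 0 < h by rewrite divr_gt0// mulr_gt0.
have h2 : h <= 2^-1.
  rewrite /h invfM mulrCA ler_piMr ?invr_ge0// ler_pdivrMr// mul1r lerDl.
  exact: ltW.
have hD : D * h <= e.
  rewrite /h mulrCA ler_piMr ?(ltW e0)// ler_pdivrMr ?mulr_gt0// mul1r.
  rewrite mulr2n mulrDl mul1r.
  by rewrite -[leLHS]add0r lerD// ?lerDr ltW//.
have [||s cvs s0] := sums (h * t0).
- exact: mulr_gt0.
- by rewrite ler_piMl// ?(ltW t00)// (le_trans h2)// invf_le1// ler1n.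
have hm0 : 0 < h ^+ m by rewrite exprn_gt0.
exists ((s : F) / h ^+ m - c m * t0 ^+ m); last first.
  by rewrite addrC subrK divr_ge0// ltW.
move/cvgrPdist_lt : cvs => /(_ _ (exprn_gt0 m.+1 h0))[N _].
move=> /(_ (N + m.+1)%N (leq_addr _ _)) /ltW.
set S := series _ _ => HS.
have SE : S = c m * (h * t0) ^+ m + \sum_(j < N) c (m.+1 + j)%N * (h * t0) ^+ (m.+1 + j).
  rewrite /S /series/= big_mkord addnC big_split_ord/= big_ord_recr/=.
  by rewrite big1 ?add0r// => i _; rewrite cm// mul0r.
have tail : `|S - c m * (h * t0) ^+ m| <= 2 * M * h ^+ m.+1.
  rewrite SE [X in `|X|]addrC addKr; apply: le_trans (ler_norm_sum _ _ _) _.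
  apply: (@le_trans _ _ (\sum_(j < N) M * h ^+ m.+1 * h ^+ j)).
    apply: ler_sum => j _; rewrite -mulrA -exprD exprMn mulrCA normrM mulrC.
    have hj : 0 <= h ^+ (m.+1 + j) by rewrite exprn_ge0// ltW.
    by rewrite (ger0_norm hj) ler_wpM2r.
  rewrite -mulr_sumr mulrC -[leRHS]mulrA ler_wpM2r ?geometric_sum_le2 ?(ltW h0)//.
  by rewrite mulr_ge0// exprn_ge0// ltW.
apply: le_trans hD; rewrite -(ler_pM2r hm0).
rewrite -[X in _ * X <= _](ger0_norm (ltW hm0)) -normrM.
have -> : ((s : F) / h ^+ m - c m * t0 ^+ m) * h ^+ m
    = ((s : F) - S) + (S - c m * (h * t0) ^+ m).
  by rewrite mulrBl divfK ?gt_eqF// [(h * t0) ^+ m]exprMn; ring.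
apply: le_trans (ler_normD _ _) _; apply: le_trans (lerD HS tail) _.
by rewrite le_eqVlt; apply/orP; left; apply/eqP; rewrite /D exprS; ring.
Qed.

Lemma series_sum (I : finType) (f : I -> nat -> F^o) (l : I -> F^o) :
  (forall i, series (f i) @ \oo --> l i) ->
  series (fun k => \sum_i f i k) @ \oo --> \sum_i l i.
Proof.
move=> fl.
have -> : series (fun k => \sum_i f i k) = (fun n => \sum_i series (f i) n).
  by apply/funext => n; rewrite /series/= exchange_big.
elim: (index_enum I) => [|i r IH].
  under eq_fun do rewrite big_nil.
  by rewrite big_nil; exact: cvg_cst.
under eq_fun do rewrite big_cons.
by rewrite big_cons; exact: cvgD.
Qed.

Lemma sum_pair (I J : finType) (f : I * J -> F) :
  \sum_k f k = \sum_i \sum_j f (i, j).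
Proof. by rewrite pair_bigA; apply: eq_bigr => -[]. Qed.

Lemma ip_ge0 d (z : 'cV[F]_d) : 0 <= ip z z.
Proof. by apply: sumr_ge0 => k _; exact: mul_conjC_ge0. Qed.

Lemma ipDl d (z z' w : 'cV[F]_d) : ip (z + z') w = ip z w + ip z' w.
Proof.
by rewrite /ip -big_split; apply: eq_bigr => k _; rewrite !mxE mulrDl.
Qed.

Lemma ipDr d (z w w' : 'cV[F]_d) : ip z (w + w') = ip z w + ip z w'.
Proof.
by rewrite /ip -big_split; apply: eq_bigr => k _; rewrite !mxE rmorphD mulrDr.
Qed.

Lemma ipZl d u (z w : 'cV[F]_d) : ip (u *: z) w = u * ip z w.
Proof.
by rewrite /ip mulr_sumr; apply: eq_bigr => k _; rewrite !mxE mulrA.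
Qed.

Lemma ipZr d u (z w : 'cV[F]_d) : ip z (u *: w) = u^* * ip z w.
Proof.
rewrite /ip mulr_sumr; apply: eq_bigr => k _.
by rewrite !mxE rmorphM mulrCA.
Qed.

Lemma dpZ d u v (z x : 'cV[F]_d) : dp (u *: z) (v *: x) = u * v * dp z x.
Proof.
by rewrite /dp mulr_sumr; apply: eq_bigr => k _; rewrite !mxE mulrACA.
Qed.

(** Cauchy-Schwarz, from [0 <= ip v v] at [v = x *: w + y *: z]. It places inner products of points
    of the ball in the disc where the series converge. *)
Lemma ip_lt1 d (z w : 'cV[F]_d) : `|ip z z| < 1 -> `|ip w w| < 1 -> `|ip z w| < 1.
Proof.
rewrite (ger0_norm (ip_ge0 z)) (ger0_norm (ip_ge0 w)) => z1 w1.
rewrite -(@expr_lt1 _ 2)//; apply: le_lt_trans (_ : ip w w * ip z z < 1).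
  apply: (@cross_term_sqr_le _ _ _ _ (ip w z)) => x y.
  have := ip_ge0 (x *: w + y *: z); rewrite ipDl !ipDr !ipZl !ipZr.
  by congr (0 <= _); ring.
by rewrite mulr_ilt1// ip_ge0.
Qed.

Lemma ktermZ a1 a2 d l (z w x y : 'cV[F]_d) u v s t :
  kterm a1 a2 l (u *: z) (v *: w) (s *: x) (t *: y)
  = (u * v^*) ^+ l * (s * t^*) * kterm a1 a2 l z w x y.
Proof.
rewrite /kterm !ipZl !ipZr !dpZ; case: l => [|l].
  by rewrite !expr0; ring.
by rewrite !rmorphM !exprS !exprMn /=; ring.
Qed.

(** * Positivity of the sum against positivity of each degree *)

Section PositiveCoefficients.
Variables (d : nat) (a1 a2 : nat -> F).
Variable V : 'cV[F]_d -> 'cV[F]_d -> 'cV[F]_d -> 'cV[F]_d -> F^o.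
Hypothesis cvV : forall z w x y, `|ip z w| < 1 ->
  series (fun l => kterm a1 a2 l z w x y : F^o) @ \oo --> V z w x y.

Let cv_kform T (z x : T -> 'cV[F]_d) : (forall i, `|ip (z i) (z i)| < 1) ->
  series (fun l => kform a1 a2 l z x : F^o) @ \oo -->
    \sum_i \sum_j V (z i) (z j) (x j) (x i).
Proof.
move=> z1; apply: (@series_sum T (fun i l => \sum_j kterm a1 a2 l (z i) (z j) (x j) (x i))) => i.
apply: (@series_sum T (fun j l => kterm a1 a2 l (z i) (z j) (x j) (x i))) => j.
by apply: cvV; exact: ip_lt1.
Qed.

Lemma kform_series_ge0 T (z x : T -> 'cV[F]_d) :
  0 <= a2 0%N -> (forall l, (0 < l)%N -> 0 <= a1 l /\ 0 <= l.+1%:R * a2 l - a1 l) ->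
  (forall i, `|ip (z i) (z i)| < 1) ->
  0 <= (\sum_i \sum_j V (z i) (z j) (x j) (x i) : F).
Proof.
move=> a20 a12 z1; apply: series_ge0 (cv_kform z1) _ => l.
by apply: kform_ge0 => //; exact: a12.
Qed.

Hypothesis V_ge0 : forall T (z x : T -> 'cV[F]_d),
  (forall i, `|ip (z i) (z i)| < 1) ->
  0 <= (\sum_i \sum_j V (z i) (z j) (x j) (x i) : F).

(* Weighted dilates [e a z_i], with the weights killing the moments of order
   [< m], turn the form into a power series in [e ^ 2] with leading
   coefficient the degree [m] part. *)
Lemma kform_of_series_ge0 m T (z x : T -> 'cV[F]_d) : 0 <= kform a1 a2 m z x.
Proof.
have [v vm] := @moment_weights F m.+1 m (leqnn _).
pose mu l := \sum_a v a * a%:R ^+ l.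
(* The inserted factor is 1; it gives all degrees the common shape [mu l * (mu l)^*], which vanishes
   for [l < m]. *)
suff : 0 <= mu m * (mu m)^* * kform a1 a2 m z x.
  by rewrite /mu vm// eqxx conjC1 !mul1r.
(* [B] bounds the squared norms of all [a z_i] with [a <= m], so dilating by [sqrtC t] with
   [t <= (1 + B)^-1] lands in the ball. *)
pose B := m%:R ^+ 2 * \sum_i ip (z i) (z i).
have B0 : 0 <= B by rewrite mulr_ge0 ?exprn_ge0// sumr_ge0// => i _; exact: ip_ge0.
have B1 : 0 < 1 + B by rewrite ltr_wpDr.
apply: (@lead_coef_ge0 (fun l => mu l * (mu l)^* * kform a1 a2 l z x) m (1 + B)^-1).
- by rewrite invr_gt0.
- move=> t t0 tB; pose e := sqrtC t.
  have e0 : 0 <= e by rewrite sqrtC_ge0 ltW.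
  have ce : e^* = e by apply: conj_Creal; exact: ger0_real.
  have ee : e * e = t by rewrite -expr2 sqrtCK.
  pose z' (k : T * 'I_m.+1) := (e * k.2%:R) *: z k.1.
  pose x' (k : T * 'I_m.+1) := v k.2 *: x k.1.
  have z'1 k : `|ip (z' k) (z' k)| < 1.
    rewrite ger0_norm ?ip_ge0// ipZl ipZr rmorphM/= ce conjC_nat.
    have -> : e * k.2%:R * (e * k.2%:R * ip (z k.1) (z k.1))
      = t * (k.2%:R ^+ 2 * ip (z k.1) (z k.1)) by rewrite -ee; ring.
    apply: (@le_lt_trans _ _ (t * B)).
      rewrite ler_wpM2l ?(ltW t0)// ler_pM ?ip_ge0 ?exprn_ge0//.
        by rewrite lerXn2r ?nnegrE// ler_nat -ltnS.
      by rewrite (bigD1 k.1)//= lerDl sumr_ge0// => i _; exact: ip_ge0.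
    apply: (@le_lt_trans _ _ ((1 + B)^-1 * B)); first by rewrite ler_wpM2r.
    by rewrite mulrC ltr_pdivrMr// mul1r ltrDr.
  exists (\sum_i \sum_j V (z' i) (z' j) (x' j) (x' i)); last exact: V_ge0.
  have -> : (fun l => mu l * (mu l)^* * kform a1 a2 l z x * t ^+ l : F^o)
      = (fun l => kform a1 a2 l z' x'); last exact: cv_kform.
  apply/funext => l; rewrite /kform sum_pair.
  rewrite mulr_sumr mulr_suml; apply: eq_bigr => i _.
  under [RHS]eq_bigr do rewrite sum_pair.
  rewrite exchange_big/= mulr_sumr mulr_suml; apply: eq_bigr => j _.
  rewrite /mu rmorph_sum mulrC big_distrlr/= exchange_big/= !mulrA mulr_sumr !mulr_suml.
  apply: eq_bigr => a _; rewrite mulr_sumr !mulr_suml; apply: eq_bigr => b _.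
  rewrite /z' /x'/= ktermZ !rmorphM/= rmorphXn/= ce !conjC_nat.
  rewrite -ee !exprMn; ring.
- by move=> l lm; rewrite /mu vm ?ltnS ?(ltnW lm)// (ltn_eqF lm) !mul0r.
Qed.

End PositiveCoefficients.

End KernelSeries.

(** * Multiplication operators and positivity of the shifted kernel *)

Section MultiplicationOperators.
Variables (F : numClosedFieldType) (d : nat).
Implicit Types (T : finType) (K : 'cV[F]_d -> 'cV[F]_d -> 'M[F]_d).
Implicit Types (f : 'cV[F]_d -> 'cV[F]_d).

(** Arbitrary finite index types let two families of points be joined over a sum type. *)
Definition kernel_form K T (z x : T -> 'cV[F]_d) : F :=
  \sum_i \sum_j ip (K (z i) (z j) *m x j) (x i).

Definition psd_kernel K := forall T (z x : T -> 'cV[F]_d),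
  (forall i, `|ip (z i) (z i)| < 1) -> 0 <= kernel_form K z x.

Definition in_rkhs K f (c : F) := forall T (z x : T -> 'cV[F]_d),
  (forall i, `|ip (z i) (z i)| < 1) ->
  `|\sum_i ip (f (z i)) (x i)| ^+ 2 <= c * kernel_form K z x.

Lemma sum_enum_val (V : nmodType) T (f : T -> V) :
  \sum_(k < #|T|) f (enum_val k) = \sum_i f i.
Proof. by rewrite -big_enum_val; apply: eq_bigl. Qed.

Lemma kernel_form_enum_val K T (z x : T -> 'cV[F]_d) :
  kernel_form K (fun k : 'I_#|T| => z (enum_val k)) (fun k => x (enum_val k))
  = kernel_form K z x.
Proof.
rewrite /kernel_form.
rewrite (sum_enum_val (fun i => \sum_(j < #|T|)
  ip (K (z i) (z (enum_val j)) *m x (enum_val j)) (x i))).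
by apply: eq_bigr => i _; rewrite (sum_enum_val (fun j => ip (K (z i) (z j) *m x j) (x i))).
Qed.

Lemma ip_suml I (r : seq I) (P : pred I) (g : I -> 'cV[F]_d) y :
  ip (\sum_(i <- r | P i) g i) y = \sum_(i <- r | P i) ip (g i) y.
Proof.
apply: (big_morph (fun v => ip v y)) => [u v|]; first exact: ipDl.
by rewrite -(scale0r (0 : 'cV[F]_d)) ipZl mul0r.
Qed.

(** On the joined family [u x_i] at [z_i], [v y_j] at [w_j], positivity is that of a quadratic form
    in [u] and [v], to which [cross_term_sqr_le] applies. *)
Lemma psd_cauchy_schwarz K (S T : finType) (z x : S -> 'cV[F]_d) (w y : T -> 'cV[F]_d) :
  psd_kernel K ->
  (forall i, `|ip (z i) (z i)| < 1) -> (forall i, `|ip (w i) (w i)| < 1) ->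
  `|\sum_i \sum_j ip (K (z i) (w j) *m y j) (x i)| ^+ 2
    <= kernel_form K z x * kernel_form K w y.
Proof.
move=> Kpsd z1 w1.
apply: (cross_term_sqr_le (B' := \sum_j \sum_i ip (K (w j) (z i) *m x i) (y j))) => u v.
pose p k := match k with inl i => z i | inr j => w j end.
pose q k := match k with inl i => u *: x i | inr j => v *: y j end.
have := Kpsd _ p q; rewrite /kernel_form big_sumType/=.
under eq_bigr do rewrite big_sumType/=.
under [X in _ + X]eq_bigr do rewrite big_sumType/=.
have bilin (S' T' : finType) (Z X : S' -> 'cV[F]_d) (W Y : T' -> 'cV[F]_d) (a b : F) :
    \sum_i \sum_j ip (K (Z i) (W j) *m (a *: Y j)) (b *: X i)
    = a * b^* * \sum_i \sum_j ip (K (Z i) (W j) *m Y j) (X i).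
  rewrite mulr_sumr; apply: eq_bigr => i _; rewrite mulr_sumr.
  by apply: eq_bigr => j _; rewrite -scalemxAr ipZl ipZr mulrA.
rewrite !big_split/= !bilin => H.
have {H} := H (fun k => match k with inl i => z1 i | inr j => w1 j end).
by congr (0 <= _); rewrite -/(kernel_form K z x) -/(kernel_form K w y); ring.
Qed.

(** For [h = sum_j K(., z_j) x_j], the adjoint [M_k^*] scales [x_j] by [conj(z_j k)], so this is
    [c |h|^2 - sum_k |M_k^* h|^2]. *)
Lemma kernel_form_shift K T (z x : T -> 'cV[F]_d) (c : F) :
  kernel_form (fun u v => (c - ip u v) *: K u v) z x
  = c * kernel_form K z x
    - \sum_k kernel_form K z (fun i => (z i k 0)^* *: x i).
Proof.
rewrite /kernel_form mulr_sumr [X in _ - X]exchange_big -sumrB; apply: eq_bigr => i _ /=.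
rewrite mulr_sumr [X in _ - X]exchange_big -sumrB; apply: eq_bigr => j _ /=.
rewrite -scalemxAl ipZl mulrBl; congr (_ - _).
rewrite {1}/ip mulr_suml; apply: eq_bigr => k _.
by rewrite -scalemxAr ipZl ipZr conjCK; ring.
Qed.

(* The reproducing property turns the bound on [M_i] into one on its adjoint,
   tested on [h = M_i^* (sum_j K(., z_j) x_j)]. *)
Lemma adjoint_bound K (k : 'I_d) (C : F) T (z x : T -> 'cV[F]_d) :
  psd_kernel K -> 0 <= C ->
  (forall f c, 0 <= c -> in_rkhs K f c -> in_rkhs K (fun z => z k 0 *: f z) (C * c)) ->
  (forall i, `|ip (z i) (z i)| < 1) ->
  kernel_form K z (fun i => (z i k 0)^* *: x i) <= C * kernel_form K z x.
Proof.
move=> Kpsd C0 Mk z1; pose y i := (z i k 0)^* *: x i.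
pose h u := \sum_j K u (z j) *m y j.
set q := kernel_form K z y.
have q0 : 0 <= q by exact: Kpsd.
have hq : in_rkhs K h q.
  move=> S w v w1; under eq_bigr do rewrite /h ip_suml.
  by rewrite mulrC; exact: psd_cauchy_schwarz.
have := Mk _ _ q0 hq T z x z1.
have -> : \sum_i ip (z i k 0 *: h (z i)) (x i) = q.
  apply: eq_bigr => i _; rewrite ipZl -[z i k 0]conjCK -ipZr.
  by rewrite /h ip_suml.
(* The bound now reads [q * q <= C * q * kernel_form K z x]; [q] cancels unless it is 0. *)
rewrite (ger0_norm q0) expr2; move: q0; rewrite le0r => /orP[/eqP -> _|q0].
  by rewrite mulr_ge0// Kpsd.
by rewrite [C * q]mulrC -mulrA ler_pM2l.
Qed.

(** The constant [d * C] comes from adding the adjoint bounds of the [d] coordinates. *)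
Lemma psd_shift_of_bounded K (C : F) : psd_kernel K -> 0 <= C ->
  (forall k f c, 0 <= c -> in_rkhs K f c ->
     in_rkhs K (fun z => z k 0 *: f z) (C * c)) ->
  psd_kernel (fun z w => (d%:R * C - ip z w) *: K z w).
Proof.
move=> Kpsd C0 M T z x z1; rewrite kernel_form_shift subr_ge0.
apply: (@le_trans _ _ (\sum_(k < d) C * kernel_form K z x)).
  by apply: ler_sum => k _; apply: adjoint_bound => // f c; exact: M.
by rewrite sumr_const card_ord -mulrA mulr_natl.
Qed.

(** Testing [z_k f] against [x] is testing [f] against [conj(z_k) x]; the shift bounds the sum of
    all [|M_k^* h|^2], hence each of them. *)
Lemma bounded_of_psd_shift K (C : F) (k : 'I_d) f (c : F) : psd_kernel K ->
  psd_kernel (fun z w => (C - ip z w) *: K z w) -> c \is Num.real ->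
  in_rkhs K f c -> in_rkhs K (fun z => z k 0 *: f z) (C * c).
Proof.
move=> Kpsd shift cr fc T z x z1; pose y i := (z i k 0)^* *: x i.
have -> : \sum_i ip (z i k 0 *: f (z i)) (x i) = \sum_i ip (f (z i)) (y i).
  by apply: eq_bigr => i _; rewrite ipZl ipZr conjCK.
apply: le_trans (fc T z y z1) _.
have q0 := Kpsd T z x z1; have qy0 := Kpsd T z y z1.
have [c0|c0] := real_ge0P cr.
  rewrite [C * c]mulrC -mulrA ler_wpM2l//.
  have := shift T z x z1; rewrite kernel_form_shift subr_ge0; apply: le_trans.
  by rewrite (bigD1 k)//= lerDl sumr_ge0// => i _; exact: Kpsd.
(* For [c < 0], membership forces the kernel form to vanish, and both sides are 0. *)
have null v : kernel_form K z v = 0.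
  apply/eqP; rewrite eq_le Kpsd// andbT -(nmulr_rge0 _ c0).
  by apply: le_trans (fc T z v z1); rewrite exprn_ge0.
by rewrite !null !mulr0.
Qed.

End MultiplicationOperators.

(** * Coefficient criteria for the kernel and its shift *)

Section TwoSeriesKernel.
Variables (F : numClosedFieldType) (d : nat).
Implicit Types (K : 'cV[F]_d -> 'cV[F]_d -> 'M[F]_d).

Definition kernel_expansion (a1 a2 : nat -> F) K := forall z w x y : 'cV[F]_d, `|ip z w| < 1 ->
  series (fun l => kterm a1 a2 l z w x y : F^o) @ \oo --> (ip (K z w *m x) y : F^o).

Lemma series_kterm (a1 a2 : nat -> F) (z w x y : 'cV[F]_d) (A B : F^o) :
  series (fun k => (a1 k.+1 - a2 k.+1) * ip z w ^+ k : F^o) @ \oo --> A ->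
  series (fun l => a2 l * ip z w ^+ l : F^o) @ \oo --> B ->
  series (fun l => kterm a1 a2 l z w x y : F^o) @ \oo -->
    (ip (((A : F) *: (\matrix_(i, j) ((w i 0)^* * z j 0)) + (B : F) *: 1%:M) *m x) y : F^o).
Proof.
move=> cA; rewrite -(cvg_shiftS _) => cB; rewrite -(cvg_shiftS _).
have -> : ip (((A : F) *: (\matrix_(i, j) ((w i 0)^* * z j 0)) + (B : F) *: 1%:M) *m x) y
    = (B : F) * ip x y + (A : F) * (dp z x * (dp w y)^*).
  rewrite mulmxDl -!scalemxAl mul1mx ipDl !ipZl addrC; congr (_ + _ * _).
  rewrite /ip /dp rmorph_sum mulr_sumr; apply: eq_bigr => i _.
  rewrite mxE rmorphM mulrA; congr (_ * _); rewrite mulr_suml.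
  by apply: eq_bigr => j _; rewrite mxE; ring.
(* Term [k] of the first series has degree [k + 1], so its partial sums lag by one. *)
have -> : [sequence series (fun l => kterm a1 a2 l z w x y : F^o) n.+1]_n
  = (fun n => series (fun l => a2 l * ip z w ^+ l : F^o) n.+1 * (ip x y : F^o)
     + series (fun k => (a1 k.+1 - a2 k.+1) * ip z w ^+ k : F^o) n
         * (dp z x * (dp w y)^* : F^o)).
  apply/funext => n /=; rewrite /series/= !big_mkord !big_ord_recl/=.
  by rewrite /kterm/= big_split/= -!mulr_suml addr0; ring.
by apply: cvgD; apply: cvgM => //; exact: cvg_cst.
Qed.

Lemma psd_kernel_coefP (a1 a2 : nat -> F) K : (1 < d)%N -> kernel_expansion a1 a2 K ->
  psd_kernel K <-> 0 <= a2 0%N /\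
    (forall l, (0 < l)%N -> 0 <= a1 l /\ 0 <= l.+1%:R * a2 l - a1 l).
Proof.
move=> d1 expK; split => [Kpsd|[a20 a12] T z x z1]; last first.
  exact: (kform_series_ge0 expK).
have kf m T z x := @kform_of_series_ge0 _ _ _ _ _ expK Kpsd m T z x.
split; first by apply: coef0_ge0 (ltnW d1) (kf 0%N).
by move=> l l0; exact: coef_ge0 d1 l0 (kf l).
Qed.

(* Coefficients of [(c - <z, w>) K(z, w)], with the convention [a1 0 = a2 0]. *)
Definition shift1 (c : F) (a1 a2 : nat -> F) l :=
  c * a1 l - (if l.-1 == 0%N then a2 0%N else a1 l.-1).
Definition shift2 (c : F) (a2 : nat -> F) l := c * a2 l - (if l is k.+1 then a2 k else 0).

(** Multiplication by [p = ip z w] raises the degree by one, so the partial sums are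
    [c * S_(n+1) - p * S_n]. The degree 0 part has no rank-one term, whence the convention
    [a1 0 = a2 0]. *)
Lemma kernel_expansion_shift (c : F) (a1 a2 : nat -> F) K : kernel_expansion a1 a2 K ->
  kernel_expansion (shift1 c a1 a2) (shift2 c a2) (fun z w => (c - ip z w) *: K z w).
Proof.
move=> expK z w x y zw; have := expK z w x y zw => cvK.
rewrite -(cvg_shiftS _) -scalemxAl ipZl mulrBl.
have -> : [sequence series (fun l => kterm (shift1 c a1 a2) (shift2 c a2) l z w x y : F^o) n.+1]_n
  = (fun n => (c : F^o) * series (fun l => kterm a1 a2 l z w x y : F^o) n.+1
     - (ip z w : F^o) * series (fun l => kterm a1 a2 l z w x y : F^o) n).
  apply/funext => n /=; rewrite /series/= !big_mkord !big_ord_recl/=.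
  rewrite mulrDr !mulr_sumr -[RHS]addrA -sumrB; congr (_ + _).
    by rewrite /kterm /shift2 expr0; ring.
  apply: eq_bigr => i _; rewrite /kterm /shift1 /shift2 /bump/= add1n.
  by case: (nat_of_ord i) => [|k] /=; rewrite ?exprS ?expr0; ring.
apply: cvgB; apply: cvgM; try exact: cvg_cst; last exact: cvK.
by move: cvK; rewrite -(cvg_shiftS _).
Qed.

Lemma shift_coef_ge0P (c : F) (a1 a2 : nat -> F) : 0 <= c -> 0 <= a2 0%N ->
  (forall l, (0 < l)%N -> 0 < a1 l /\ 0 < l.+1%:R * a2 l - a1 l) ->
  (0 <= shift2 c a2 0 /\ (forall l, (0 < l)%N -> 0 <= shift1 c a1 a2 l /\
      0 <= l.+1%:R * shift2 c a2 l - shift1 c a1 a2 l)) <->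
  (forall l, (0 < l)%N ->
    (l.+1%:R * a2 l.-1 - (if l.-1 == 0%N then a2 0%N else a1 l.-1))
      / (l.+1%:R * a2 l - a1 l) <= c
    /\ (if l.-1 == 0%N then a2 0%N else a1 l.-1) / a1 l <= c).
Proof.
move=> c0 a20 a12.
(* The degree [l] weight uses the factor [l + 1] on both shifted coefficients, which is why the
   numerator carries [l + 1] with index [l - 1]. *)
have step l : (0 < l)%N ->
    l.+1%:R * shift2 c a2 l - shift1 c a1 a2 l = c * (l.+1%:R * a2 l - a1 l)
      - (l.+1%:R * a2 l.-1 - (if l.-1 == 0%N then a2 0%N else a1 l.-1)).
  by case: l => // l _; rewrite /shift1 /shift2 /=; ring.
split => [[_ H] l l0|H].
  have [a1l a12l] := a12 l l0; rewrite !ler_pdivrMr// -subr_ge0 -step//.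
  by have [h1 h2] := H l l0; split=> //; rewrite -subr_ge0.
split; first by rewrite /shift2 subr0 mulr_ge0.
move=> l l0; have [a1l a12l] := a12 l l0; have [] := H l l0.
by rewrite !ler_pdivrMr// step// /shift1 !subr_ge0.
Qed.

End TwoSeriesKernel.

Local Open Scope complex_scope.

(** * Passage to [R[i]] and the given kernel *)

Section ComplexBall.
Variables (R : realType) (d : nat).
Implicit Types (K : 'cV[R[i]]_d -> 'cV[R[i]]_d -> 'M[R[i]]_d).
Implicit Types (f : 'cV[R[i]]_d -> 'cV[R[i]]_d).

Lemma nonneg_def_psd K : nonneg_def_kernel K -> psd_kernel K.
Proof.
move=> Kpsd T z x z1; rewrite -kernel_form_enum_val.
by apply: Kpsd => j; exact: z1.
Qed.

Lemma inHK_in_rkhs K f (c : R) : inHK K f c <-> in_rkhs K f c%:C.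
Proof.
split=> [fc T z x z1|fc n z x z1]; last exact: fc.
rewrite -kernel_form_enum_val -(sum_enum_val (fun i => ip (f (z i)) (x i))).
by apply: fc => j; exact: z1.
Qed.

Lemma Kker_expansion (a1 a2 : nat -> R[i]) :
  (forall t : R[i], `|t| < 1 ->
     cvg (seriesA a1 a2 t @ \oo) /\ cvg (seriesB a2 t @ \oo)) ->
  kernel_expansion a1 a2 (@Kker R d a1 a2).
Proof.
by move=> conv z w x y /conv[cA cB]; exact: series_kterm cA cB.
Qed.

End ComplexBall.

(** * Boundedness and the two quotients *)

Theorem theorem4p1 (R : realType) (d : nat) (a1 a2 : nat -> R[i]) :
  (2 <= d)%N ->
  (* the defining series converge on the relevant range |<z,w>| < 1 *)
  (forall t : R[i], `|t| < 1 ->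
     cvg (seriesA a1 a2 t @ \oo) /\ cvg (seriesB a2 t @ \oo)) ->
  nonneg_def_kernel (@Kker R d a1 a2) ->
  (* the quotients in the statement are well defined *)
  (forall l : nat, (1 <= l)%N ->
     a1ext a1 a2 l != 0 /\ (l.+1)%:R * a2 l - a1ext a1 a2 l != 0) ->
  mult_tuple_bounded (@Kker R d a1 a2) <->
  exists B : R, forall l : nat, (1 <= l)%N ->
    ((l.+1)%:R * a2 l.-1 - a1ext a1 a2 l.-1) / ((l.+1)%:R * a2 l - a1ext a1 a2 l)
      <= B%:C
    /\ a1ext a1 a2 l.-1 / a1ext a1 a2 l <= B%:C.
Proof.
move=> d2 /Kker_expansion expK /nonneg_def_psd Kpsd nz.
have [a20 a12_ge0] := (psd_kernel_coefP d2 (expK d)).1 Kpsd.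
(* Nonnegative weights that are nonzero are positive, so the denominators can be cleared. *)
have a12 l : (0 < l)%N -> 0 < a1 l /\ 0 < l.+1%:R * a2 l - a1 l.
  move=> l0; have [h1 h2] := a12_ge0 l l0; have := nz l l0.
  by case: l l0 h1 h2 => // l _ h1 h2 [n1 n2]; split; rewrite lt0r ?h1 ?h2 andbT.
have shiftP (C : R) : 0 <= C ->
    psd_kernel (fun z w => (C%:C - ip z w) *: Kker (d := d) a1 a2 z w) <->
    (forall l, (1 <= l)%N ->
      (l.+1%:R * a2 l.-1 - a1ext a1 a2 l.-1) / (l.+1%:R * a2 l - a1ext a1 a2 l)
        <= C%:C
      /\ a1ext a1 a2 l.-1 / a1ext a1 a2 l <= C%:C).
  move=> C0; have C0' : 0 <= C%:C by rewrite lecR.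
  rewrite (psd_kernel_coefP d2 (kernel_expansion_shift (c := C%:C) (expK d))).
  rewrite (shift_coef_ge0P C0' a20 a12).
  by split => H [|l] // l0; exact: (H l.+1).
split => [[C0 bdd]|[B HB]].
  (* The shift criterion needs a nonnegative constant; enlarging [C0] is harmless as [c] and the
     kernel form are nonnegative. *)
  pose C := Num.max C0 0; have C_ge0 : 0 <= C by rewrite le_max lexx orbT.
  have dC_ge0 : 0 <= d%:R * C by rewrite mulr_ge0.
  exists (d%:R * C); apply/(shiftP _ dC_ge0).
  rewrite rmorphM rmorph_nat; apply: psd_shift_of_bounded => //.
    by rewrite lecR.
  move=> k f c c0; have cE : (complex.Re c)%:C = c by rewrite RRe_real// ger0_real.
  rewrite -cE => /inHK_in_rkhs/(bdd k)/inHK_in_rkhs fk T z x z1.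
  apply: le_trans (fk T z x z1) _; rewrite ler_wpM2r ?Kpsd// -rmorphM lecR.
  by rewrite ler_wpM2r ?le_max ?lexx// -lecR cE.
pose C := Num.max B 0; have C_ge0 : 0 <= C by rewrite le_max lexx orbT.
have Cpsd : psd_kernel (fun z w => (C%:C - ip z w) *: Kker (d := d) a1 a2 z w).
  apply/(shiftP _ C_ge0) => l l1; have [h1 h2] := HB l l1.
  have BC : B%:C <= C%:C by rewrite lecR le_max lexx.
  by split; [exact: le_trans h1 BC | exact: le_trans h2 BC].
exists C => k f c /inHK_in_rkhs fc; apply/inHK_in_rkhs.
rewrite rmorphM; apply: bounded_of_psd_shift => //.
by apply/complex_realP; exists c.
Qed.
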